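(* Let $n\ge 7$ and let $G\in\mathcal{BG}_{n,\kappa}$, i.e. $G$ is a connected bipartite graph of order $n$ with vertex connectivity $\kappa$. (i) If $\kappa\in\left\{\frac{n-2}{2},\frac{n-1}{2},\frac{n}{2}\right\}$, then $\mathcal{ABS}(G)\le \kappa(n-\kappa)\sqrt{1-\frac{2}{n}}$. Equality holds if and only if $G\cong K_{\kappa,n-\kappa}$. (ii) If $n$ is even and $1\le \kappa\le \frac{n-4}{2}$, then $$\mathcal{ABS}(G)\le \frac{n(n-2\kappa-2)}{4}\sqrt{1-\frac{2}{n-1}}+\frac{n\kappa}{2}\sqrt{1-\frac{2}{n}}+\kappa\sqrt{1-\frac{4}{2\kappa+n+2}}.$$ Equality holds if and only if $G\cong \overline{\mathcal{K}}_{\kappa}\left[\frac{n}{2},\frac{n-2\kappa-2}{2}\right]$. (iii) If $n$ is odd and $1\le \kappa\le \frac{n-3}{2}$, then $$\mathcal{ABS}(G)\le \frac{(n-1)(n-2\kappa-1)}{4}\sqrt{1-\frac{2}{n-1}}+\frac{(n-1)\kappa}{2}\sqrt{1-\frac{2}{n}}+\kappa\sqrt{1-\frac{4}{2\kappa+n+1}}.$$ Equality holds if and only if $G\cong \overline{\mathcal{K}}_{\kappa}\left[\frac{n-1}{2},\frac{n-2\kappa-1}{2}\right]$.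
   Context: All graphs are finite and simple. The $\mathcal{ABS}$ index of a graph $G$ is $\mathcal{ABS}(G)=\sum_{uv\in E(G)}\sqrt{1-\frac{2}{d(u)+d(v)}}$, where $d(v)$ is the degree of $v$ in $G$. The vertex connectivity $\kappa$ of $G$ is the cardinality of a minimum vertex cut set. $\mathcal{BG}_{n,\kappa}$ is the class of connected bipartite graphs of order $n$ with vertex connectivity $\kappa$. $K_{a,b}$ is the complete bipartite graph with parts of sizes $a$ and $b$. For positive integers $x,y,\kappa$, the graph $\overline{\mathcal{K}}_\kappa[x,y]$ has $x+1+y+\kappa$ vertices, its vertex set being the disjoint union of independent sets $H_1,H_3,H_4,H_5$ with $|H_1|=x$, $|H_3|=1$, $|H_4|=y$, $|H_5|=\kappa$; its edges are all pairs joining a vertex of $H_1$ to a vertex of $H_4\cup H_5$, and all pairs joining the vertex of $H_3$ to a vertex of $H_5$ (and no other edges). *)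

(* Defs.v *)
From mathcomp Require Import all_boot all_order all_algebra.
From mathcomp Require Import reals.
Set Implicit Arguments.
Unset Strict Implicit.
Unset Printing Implicit Defensive.
Import Order.TTheory GRing.Theory Num.Theory.

Record sgraph : Type := SGraph {
  vertex :> finType;
  adj : rel vertex;
  adj_sym : symmetric adj;
  adj_irrefl : irreflexive adj }.

Arguments adj {s} _ _ : rename.

Definition isomorphic (G H : sgraph) : Prop :=
  exists f : G -> H, bijective f /\ forall u v : G, adj (f u) (f v) = adj u v.

Section GraphNotions.
Variable G : sgraph.

Definition deg (v : G) : nat := #|[set u | adj v u]|.

Definition edges : {set {set G}} :=
  [set e : {set G} | [exists u, exists v, adj u v && (e == [set u; v])]].

(* For an edge e = {u, v}, the inner sum is d(u) + d(v). *)
Definition ABS (R : realType) : R :=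
  (\sum_(e in edges) Num.sqrt (1 - 2 / (\sum_(v in e) deg v)%:R))%R.

Definition connected : Prop := forall u v : G, connect adj u v.

Definition bipartite : Prop :=
  exists A : {set G}, forall u v : G, adj u v -> (u \in A) != (v \in A).

Definition del_adj (S : {set G}) : rel {v : G | v \notin S} :=
  fun u v => adj (val u) (val v).

Lemma del_adj_sym S : symmetric (@del_adj S).
Proof. by move=> u v; rewrite /del_adj adj_sym. Qed.

Lemma del_adj_irrefl S : irreflexive (@del_adj S).
Proof. by move=> u; rewrite /del_adj adj_irrefl. Qed.

Definition del_vertices (S : {set G}) : sgraph :=
  SGraph (@del_adj_sym S) (@del_adj_irrefl S).

End GraphNotions.

Definition vertex_cut (G : sgraph) (S : {set G}) : Prop :=
  ~ connected (del_vertices S).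

(* A relation rather than a function: a complete graph has no vertex cut, so
   [vertex_connectivity G k] then fails for every k. *)
Definition vertex_connectivity (G : sgraph) (k : nat) : Prop :=
  (exists S : {set G}, vertex_cut S /\ #|S| = k) /\
  (forall S : {set G}, vertex_cut S -> k <= #|S|).

Definition BG (n k : nat) (G : sgraph) : Prop :=
  [/\ #|G| = n, connected G, bipartite G & vertex_connectivity G k].

Section CompleteBipartite.
Variables a b : nat.

Definition Kbip_adj : rel ('I_a + 'I_b)%type :=
  fun u v => match u, v with
             | inl _, inr _ | inr _, inl _ => true
             | _, _ => false
             end.

Lemma Kbip_adj_sym : symmetric Kbip_adj.
Proof. by move=> [u|u] [v|v]. Qed.

Lemma Kbip_adj_irrefl : irreflexive Kbip_adj.
Proof. by move=> [u|u]. Qed.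

Definition Kbip : sgraph := SGraph Kbip_adj_sym Kbip_adj_irrefl.

End CompleteBipartite.

Section KBar.
Variables k x y : nat.

Inductive KBar_part := H1 | H3 | H4 | H5.

Definition KBar_vertex : finType := ('I_x + unit + 'I_y + 'I_k)%type.

Definition KBar_part_of (v : KBar_vertex) : KBar_part :=
  match v with
  | inl (inl (inl _)) => H1
  | inl (inl (inr _)) => H3
  | inl (inr _) => H4
  | inr _ => H5
  end.

Definition KBar_adj : rel KBar_vertex :=
  fun u v => match KBar_part_of u, KBar_part_of v with
             | H1, H4 | H4, H1
             | H1, H5 | H5, H1
             | H3, H5 | H5, H3 => true
             | _, _ => false
             end.

Lemma KBar_adj_sym : symmetric KBar_adj.
Proof.
by move=> u v; rewrite /KBar_adj; case: (KBar_part_of u); case: (KBar_part_of v).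
Qed.

Lemma KBar_adj_irrefl : irreflexive KBar_adj.
Proof. by move=> u; rewrite /KBar_adj; case: (KBar_part_of u). Qed.

Definition KBar : sgraph := SGraph KBar_adj_sym KBar_adj_irrefl.

End KBar.

(* Main.v *)
(* Write f(s) = sqrt(1 - 2/s), an increasing function of s, so that ABS is the
   sum of f(d(u) + d(v)) over the edges uv. A minimum cut S of G splits the other
   vertices into two nonempty sets C and D with no edge between them.  If C or D
   is contained in one part of the bipartition, its vertices have all their
   neighbours in S and so degree at most k; the graph is then dominated edge by
   edge by a complete bipartite graph with edges removed at a single vertex of
   degree d <= k, and it remains to maximise the resulting function of d and of
   the part size.  Otherwise at least n - k - 2 cross pairs are missing between
   C and D, and bounding every edge by f(n) is already enough. *)
Require Import Defs.
From mathcomp Require Import all_boot all_order all_algebra.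
From mathcomp Require Import reals zify ring lra.
Import Order.TTheory GRing.Theory Num.Theory.
Local Open Scope ring_scope.
Set Implicit Arguments.
Unset Strict Implicit.
Unset Printing Implicit Defensive.

(** * The edge weight as a function of the degree sum *)

Section Weight.
Variable R : realType.

Definition weight (s : nat) : R := Num.sqrt (1 - 2 / s%:R).

Lemma weight_ge0 s : 0 <= weight s.
Proof. exact: sqrtr_ge0. Qed.

Lemma weight_gt0 s : (3 <= s)%N -> 0 < weight s.
Proof.
move=> hs; rewrite sqrtr_gt0 subr_gt0 ltr_pdivrMr ?ltr0n; last lia.
by rewrite mul1r ltr_nat.
Qed.

Lemma weight_sqr s : (2 <= s)%N -> weight s ^+ 2 = 1 - 2 / s%:R.
Proof.
move=> hs; rewrite sqr_sqrtr // subr_ge0 ler_pdivrMr ?ltr0n; last lia.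
by rewrite mul1r ler_nat.
Qed.

Lemma weight_le s t : (2 <= s <= t)%N -> weight s <= weight t.
Proof.
case/andP=> h1 h2; apply: ler_wsqrtr; rewrite lerD2l lerN2 ler_pM2l //.
by rewrite lef_pV2 ?ler_nat // posrE ltr0n; lia.
Qed.

Lemma weight_lt s t : (2 <= s < t)%N -> weight s < weight t.
Proof.
case/andP=> h1 h2; rewrite ltr_sqrt.
  rewrite ltrD2l ltrN2 ltr_pM2l // ltf_pV2 ?ltr_nat // posrE ltr0n; lia.
rewrite subr_gt0 ltr_pdivrMr ?ltr0n; last lia.
by rewrite mul1r ltr_nat; lia.
Qed.

Lemma weight_le1 s : weight s <= 1.
Proof.
rewrite -[leRHS]sqrtr1; apply: ler_wsqrtr.
by rewrite gerBl divr_ge0.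
Qed.

(** A number in [[0, 1]] dominates its square; this trades the square root for a rational lower
    bound. *)
Lemma weight_ge s : (2 <= s)%N -> 1 - 2 / s%:R <= weight s.
Proof.
move=> hs; rewrite -weight_sqr // expr2 ler_piMl ?weight_ge0 //.
exact: weight_le1.
Qed.

(* The difference of the squares is [2 t / (s (s + t))], and the two weights
   sum to at least [1]. *)
Lemma weight_diff s t : (4 <= s)%N ->
  weight (s + t) - weight s <= 2 * t%:R / (s%:R * (s + t)%:R).
Proof.
move=> hs.
have h1 : weight (s + t) ^+ 2 - weight s ^+ 2 = 2 * t%:R / (s%:R * (s + t)%:R).
  rewrite !weight_sqr; try lia.
  have hs0 : s%:R != 0 :> R by rewrite pnatr_eq0; lia.
  have ht0 : (s + t)%:R != 0 :> R by rewrite pnatr_eq0; lia.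
  rewrite natrD in ht0 *; field.
  by rewrite hs0 ht0.
have half r : (4 <= r)%N -> 1 / 2 <= weight r.
  move=> hr; apply: le_trans (weight_ge _); last lia.
  have : 2 / r%:R <= 2 / 4 :> R.
    by rewrite ler_pM2l // lef_pV2 ?ler_nat ?posrE ?ltr0n //; lia.
  lra.
have hle : weight s <= weight (s + t) by apply: weight_le; lia.
rewrite -h1 subr_sqr ler_peMr ?subr_ge0 //.
have := half s hs; have : (4 <= s + t)%N by lia.
by move/half; lra.
Qed.

(** * Maximising over the part size and the low degree *)

Section Extremal.
Variable n : nat.

(* The value of ABS on the graph obtained from [K_{x+1,n-1-x}] by keeping only
   [d] of the edges at one vertex of the first part. *)
Definition low_degree_value (x d : nat) : R :=
  x%:R * (n%:R - 1 - x%:R) * weight n.-1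
  + x%:R * d%:R * (weight n - weight n.-1) + d%:R * weight (x + 1 + d).

Hypothesis n_ge7 : (7 <= n)%N.

Lemma weight_pred_lt : weight n.-1 < weight n.
Proof. by apply: weight_lt; lia. Qed.

(** The last term makes the growth strict; the middle one is constant when [x = 0]. *)
Lemma low_degree_value_lt x d k : (1 <= d < k)%N ->
  low_degree_value x d < low_degree_value x k.
Proof.
move=> /andP[hd hk]; rewrite /low_degree_value -!addrA ltrD2l.
apply: ler_ltD.
  apply: ler_wpM2r; first by rewrite subr_ge0 ltW ?weight_pred_lt.
  by rewrite ler_wpM2l // ler_nat ltnW.
apply: (@le_lt_trans _ _ (d%:R * weight (x + 1 + k))).
  by rewrite ler_wpM2l //; apply: weight_le; lia.
by rewrite ltr_pM2r ?ltr_nat // weight_gt0; lia.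
Qed.

Variables k m : nat.
Hypotheses (k_gt0 : (0 < k)%N) (k_lt_m : (k < m)%N).
Hypotheses (m_ge : (n <= 2 * m + 1)%N) (m_le : (2 * m <= n)%N).

(** The section hypotheses make [m] the floor of [n / 2]. The leading factor [x * (n - 1 - x)] is
    maximal at [m], with a tie at [m - 1] for even [n]; the other two terms increase with [x] and
    break the tie. Beyond [m] their growth has to be shown smaller than the loss. *)
Lemma low_degree_value_argmax x :
  x != m -> low_degree_value x k < low_degree_value m k.
Proof.
move=> xm; rewrite -subr_gt0 /low_degree_value.
have hab := weight_pred_lt.
have ka : 0 < k%:R :> R by rewrite ltr0n.
have [hx|hx] : (x < m)%N \/ (m < x)%N by lia.
  have hc : weight (x + 1 + k) <= weight (m + 1 + k) by apply: weight_le; lia.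
  have e : (x + (m - x) = m)%N by lia.
  have h1 : 0 < (m - x)%:R :> R by rewrite ltr0n; lia.
  have h2 : (n = (n - 1 - x - m) + 1 + x + m)%N by lia.
  have h3 : 0 <= (n - 1 - x - m)%:R :> R by [].
  have en : n%:R = (n - 1 - x - m)%:R + 1 + x%:R + m%:R :> R.
    by rewrite {1}h2 !natrD.
  have em : m%:R = x%:R + (m - x)%:R :> R by rewrite -natrD e.
  set t := (m - x)%:R in em h1.
  set r := (n - 1 - x - m)%:R in en h3.
  have -> : m%:R * (n%:R - 1 - m%:R) * weight n.-1 +
    m%:R * k%:R * (weight n - weight n.-1) + k%:R * weight (m + 1 + k) -
    (x%:R * (n%:R - 1 - x%:R) * weight n.-1 +
    x%:R * k%:R * (weight n - weight n.-1) + k%:R * weight (x + 1 + k)) =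
    t * r * weight n.-1 + t * k%:R * (weight n - weight n.-1)
    + k%:R * (weight (m + 1 + k) - weight (x + 1 + k)).
    by rewrite en em; ring.
  (* [r] may be zero, so strictness must come from the middle term. *)
  apply: ltr_wpDr; first by rewrite mulr_ge0 // subr_ge0.
  apply: ltr_wpDl; first by rewrite !mulr_ge0 ?weight_ge0 // ltW.
  by rewrite !mulr_gt0 // subr_gt0.
(* With [t = x - m] and [r = m + x + 1 - n], both at least 1, the leading term loses
   [t * r * weight n.-1 >= 2t/3], while the other two gain at most [t/7] and [t/6]. *)
have h1 : 1 <= (x - m)%:R :> R by rewrite ler1n; lia.
have em : x%:R = m%:R + (x - m)%:R :> R by rewrite -natrD; congr _%:R; lia.
have h3 : 1 <= (m + x + 1 - n)%:R :> R by rewrite ler1n; lia.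
have en : (m + x + 1 - n)%:R = m%:R + x%:R + 1 - n%:R :> R.
  by rewrite natrB ?natrD //; lia.
have hd : k%:R * (weight (x + 1 + k) - weight (m + 1 + k)) <= (x - m)%:R / 6.
  have -> : (x + 1 + k = (m + 1 + k) + (x - m))%N by lia.
  have /(weight_diff (x - m)) : (4 <= m + 1 + k)%N by lia.
  move=> /(ler_wpM2l (ltW ka)) /le_trans; apply.
  rewrite mulrA ler_pdivrMr -?natrM ?ltr0n; last by nia.
  rewrite mulrAC ler_pdivlMr // -!natrM ler_nat.
  set t := (x - m)%N; have : (0 < t)%N by lia.
  by nia.
have hk : k%:R * (weight n - weight n.-1) <= 1 / 7.
  have := @weight_diff n.-1 1; rewrite addn1 prednK; last lia.
  move=> /(_ ltac:(lia)) /(ler_wpM2l (ltW ka)) /le_trans; apply.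
  rewrite mulrA ler_pdivrMr -?natrM ?ltr0n; last by nia.
  rewrite mul1r mulrC ler_pdivlMr // -?natrM ler_nat; nia.
have ha : 2 / 3 <= weight n.-1.
  apply: le_trans (weight_ge _); last lia.
  have : 2 / n.-1%:R <= 2 / 6 :> R.
    by rewrite ler_pM2l // lef_pV2 ?ler_nat ?posrE ?ltr0n //; lia.
  lra.
rewrite {}em in en *.
set t := (x - m)%:R in h1 hd en *.
set r := (m + x + 1 - n)%:R in h3 en.
have -> : m%:R * (n%:R - 1 - m%:R) * weight n.-1 +
    m%:R * k%:R * (weight n - weight n.-1) + k%:R * weight (m + 1 + k) -
    ((m%:R + t) * (n%:R - 1 - (m%:R + t)) * weight n.-1 +
    (m%:R + t) * k%:R * (weight n - weight n.-1) + k%:R * weight (x + 1 + k)) =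
    t * (r * weight n.-1 - k%:R * (weight n - weight n.-1))
    - k%:R * (weight (x + 1 + k) - weight (m + 1 + k)).
  by rewrite en; ring.
have : 2 / 3 <= r * weight n.-1 by apply: le_trans ha _; rewrite ler_peMl // weight_ge0.
move=> hr.
have : t * (2 / 3 - 1 / 7) <= t * (r * weight n.-1 - k%:R * (weight n - weight n.-1)).
  by rewrite ler_wpM2l; lra.
lra.
Qed.

Lemma low_degree_value_le_max x d : (1 <= d <= k)%N ->
  low_degree_value x d <= low_degree_value m k ?= iff (x == m) && (d == k).
Proof.
move=> /andP[d1 dk].
have hx : low_degree_value x k <= low_degree_value m k.
  by have [->//|/low_degree_value_argmax/ltW] := eqVneq x m.
have [edk|ndk] := eqVneq d k; last first.
  rewrite andbF; have /low_degree_value_lt : (1 <= d < k)%N by lia.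
  move=> /(_ x) h.
  by split; [exact: ltW (lt_le_trans h hx)|exact: lt_eqF (lt_le_trans h hx)].
rewrite andbT edk; split=> //.
by have [->|/low_degree_value_argmax/lt_eqF//] := eqVneq x m; rewrite eqxx.
Qed.

(** The extremal graph has at least [n - m - 2] more edges than [e], each counted at least [5/7].
    Against this, its edges of weight [weight n.-1] cost at most [(n - m - 2)/6], and the [k] edges
    at its low-degree vertex less than 1. Since [n - m - 2 >= 2], the surplus wins. *)
Lemma few_edges_lt_max p q e : (p + q = n)%N ->
  (e + (n - k - 2) <= p * q)%N -> e%:R * weight n < low_degree_value m k.
Proof.
move=> hpq he.
(* Among the splits [p + q = n] the product is largest at the balanced one. *)
have he' : (e + (n - k - 2) <= m * (n - m))%N.
  apply: leq_trans he _.
  have [[t ep]|[t ep]] : (exists t, m = p + t)%N \/ (exists t, p = m + t)%N.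
    by case: (leqP p m) => h; [left; exists (m - p)%N|right; exists (p - m)%N]; lia.
    have -> : (n - m = q - t)%N by lia.
    have [r er] : exists r, q = (t + r)%N by exists (q - t)%N; lia.
    by rewrite er addKn ep; nia.
  have -> : (n - m = q + t)%N by lia.
  by rewrite ep; nia.
have [z hz] : exists z, (m * (n - m) = e + (n - k - 2) + z)%N.
  by exists (m * (n - m) - e - (n - k - 2))%N; lia.
move/(congr1 (fun i : nat => i%:R : R)): hz.
rewrite natrM !natrD !natrB; try lia.
move=> hz.
have z0 : 0 <= z%:R :> R by [].
have ka : 0 < k%:R :> R by rewrite ltr0n.
have hb : weight n <= 1 := weight_le1 n.
have hb' : 5 / 7 <= weight n.
  apply: le_trans (weight_ge _); last lia.
  have : 2 / n%:R <= 2 / 7 :> R.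
    by rewrite ler_pM2l // lef_pV2 ?ler_nat ?posrE ?ltr0n //; lia.
  lra.
have hr : 2 <= n%:R - 2 - m%:R :> R.
  by rewrite -!natrB ?ler_nat; lia.
have hk : m%:R * (n%:R - 1 - m%:R - k%:R) * (weight n - weight n.-1)
   <= (n%:R - 2 - m%:R) / 6.
  have -> : n%:R - 1 - m%:R - k%:R = (n - 1 - m - k)%:R :> R by rewrite !natrB //; lia.
  have -> : n%:R - 2 - m%:R = (n - 2 - m)%:R :> R by rewrite !natrB //; lia.
  have := @weight_diff n.-1 1; rewrite addn1 prednK; last lia.
  move=> /(_ ltac:(lia)) h.
  apply: le_trans (ler_wpM2l _ h) _; first by rewrite -natrM.
  rewrite mulrA ler_pdivrMr -?natrM ?ltr0n; last by nia.
  rewrite mulrAC ler_pdivlMr // -!natrM ler_nat.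
  set u := (n - 1 - m - k)%N; set v := (n - 2 - m)%N.
  have huv : (u <= v)%N by lia.
  have h12 : (m * 12 <= n.-1 * n)%N.
    apply: (@leq_trans (6 * n)); first lia.
    by rewrite leq_mul2r; lia.
  by apply: leq_trans (leq_trans (leq_mul h12 huv) _); lia.
(* Bounding [weight n] by 1 and the other weight by [weight_ge] leaves [2k/(m + 1 + k)], below 1
   because [k < m]. *)
have hc : k%:R * (weight n - weight (m + 1 + k)) < 1.
  have h : weight n - weight (m + 1 + k) <= 2 / (m + 1 + k)%:R.
    have := @weight_ge (m + 1 + k)%N; move=> /(_ ltac:(lia)); lra.
  apply: le_lt_trans (ler_wpM2l (ltW ka) h) _.
  rewrite mulrA ltr_pdivrMr ?ltr0n ?mul1r -?natrM ?ltr_nat; lia.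
have heq : low_degree_value m k - e%:R * weight n =
  z%:R * weight n + (n%:R - 2 - m%:R) * weight n
  - m%:R * (n%:R - 1 - m%:R - k%:R) * (weight n - weight n.-1)
  - k%:R * (weight n - weight (m + 1 + k)).
  have -> : e%:R = m%:R * (n%:R - m%:R) - (n%:R - k%:R - 2%:R) - z%:R :> R.
    by rewrite hz; ring.
  by rewrite /low_degree_value; ring.
suff: 0 < low_degree_value m k - e%:R * weight n by rewrite subr_gt0.
rewrite heq.
have : 0 <= z%:R * weight n by rewrite mulr_ge0 ?weight_ge0.
have : (n%:R - 2 - m%:R) * (5 / 7) <= (n%:R - 2 - m%:R) * weight n :> R.
  apply: ler_wpM2l hb'; lra.
lra.
Qed.

End Extremal.
End Weight.

(** * Equality in termwise bounds, and bijections from class sizes *)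

Lemma sum_eq_of_le (R : numDomainType) (I : finType) (P : pred I) (E F : I -> R) :
  (forall i, P i -> E i <= F i) -> \sum_(i | P i) E i = \sum_(i | P i) F i ->
  forall i, P i -> E i = F i.
Proof.
move=> hle heq i Pi; apply/eqP; rewrite eq_sym -subr_eq0; apply/eqP.
have h0 j : P j -> 0 <= F j - E j by move=> /hle; rewrite subr_ge0.
apply: (psumr_eq0P h0 _ Pi).
by rewrite sumrB heq subrr.
Qed.

(** List each class in both types and match elements at equal positions. *)
Lemma class_preserving_bij (T1 T2 : finType) (K : finType)
    (c1 : T1 -> K) (c2 : T2 -> K) :
  (forall a, #|[set x | c1 x == a]| = #|[set y | c2 y == a]|) ->
  exists f : T1 -> T2, bijective f /\ forall x, c2 (f x) = c1 x.
Proof.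
move=> hc.
pose A a := enum [set x | c1 x == a]; pose B a := enum [set y | c2 y == a].
have sAB a : size (A a) = size (B a) by rewrite -!cardE hc.
have idx x : (index x (A (c1 x)) < size (B (c1 x)))%N.
  by rewrite -sAB index_mem mem_enum inE.
(* A default for [nth]: by [idx] the target class is nonempty. It varies with [x], whence
   [set_nth_default] in the injectivity proof. *)
have f0 (x : T1) : T2.
  by case: (B (c1 x)) (idx x) => [|y _] //.
pose f (x : T1) := nth (f0 x) (B (c1 x)) (index x (A (c1 x))).
have cf x : c2 (f x) = c1 x.
  have : f x \in B (c1 x) by apply: mem_nth.
  by rewrite mem_enum inE => /eqP.
have finj : injective f.
  move=> x y fxy; have cxy : c1 x = c1 y by rewrite -cf fxy cf.
  have /eqP : f x = nth (f0 x) (B (c1 x)) (index y (A (c1 x))).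
    by rewrite fxy /f -cxy; apply: set_nth_default; rewrite cxy.
  rewrite nth_uniq ?enum_uniq ?idx //; last by rewrite cxy.
  move=> /eqP h.
  have xA : x \in A (c1 x) by rewrite mem_enum inE.
  have yA : y \in A (c1 x) by rewrite mem_enum inE cxy.
  by rewrite -(nth_index x xA) h nth_index.
exists f; split=> //.
apply: inj_card_bij finj _.
have card_cls (T : finType) (c : T -> K) : #|T| = (\sum_a #|[set x | c x == a]|)%N.
  rewrite -sum1_card (partition_big c xpredT) //=.
  by apply: eq_bigr => a _; rewrite -sum1_card; apply: eq_bigl => x; rewrite inE.
by rewrite (card_cls _ c1) (card_cls _ c2) (eq_bigr _ (fun a _ => hc a)).
Qed.

(** * ABS of a bipartite graph as a sum over cross pairs *)

Definition bipartition (G : sgraph) (A : {set G}) : Prop :=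
  forall u v : G, adj u v -> (u \in A) != (v \in A).

Lemma bipartitionC (G : sgraph) (A : {set G}) :
  bipartition A -> bipartition (~: A).
Proof. by move=> h u v /h; rewrite !inE; case: (u \in A); case: (v \in A). Qed.

Section Bipartite.
Variables (R : realType) (G : sgraph) (A : {set G}).
Hypothesis bipA : bipartition A.
Local Notation f := (@weight R).

(** Extended by zero to non-adjacent pairs, so that bounds can be compared term by term over all of
    [setX A (~: A)] and equality detects missing edges. *)
Definition edge_weight (p : G * G) : R :=
  if adj p.1 p.2 then f (deg p.1 + deg p.2) else 0.

(** Every edge has exactly one end in [A], so edges match adjacent pairs of [setX A (~: A)] one to
    one. *)
Lemma ABS_bipartition :
  ABS G R = \sum_(p in setX A (~: A)) edge_weight p.
Proof.
pose P := [set p : G * G | (p \in setX A (~: A)) && adj p.1 p.2].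
pose h (p : G * G) := [set p.1; p.2].
have hP : {in P &, injective h}.
  move=> [a b] [c d]; rewrite !inE /= => /andP[/andP[aA bA] _] /andP[/andP[cA dA] _].
  move=> /setP e; have := e a; have := e b.
  rewrite !inE !eqxx /= orbT => /esym /orP[/eqP bc|/eqP bd].
    by rewrite bc cA in bA.
  move=> /esym /orP[/eqP ac|/eqP ad]; first by rewrite ac bd.
  by rewrite -ad aA in dA.
have imP : edges G = h @: P.
  apply/setP => e; rewrite inE; apply/existsP/imsetP.
    move=> [u /existsP[v /andP[uv /eqP ->]]].
    have := bipA uv; case uA: (u \in A); case vA: (v \in A) => // _.
      by exists (u, v); rewrite // !inE /= uA vA.
    by exists (v, u); rewrite ?inE /= ?uA ?vA 1?adj_sym // /h /= setUC.
  move=> [[u v]]; rewrite !inE /= => /andP[_ uv] ->.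
  by exists u; apply/existsP; exists v; rewrite uv eqxx.
rewrite /ABS imP big_imset //=.
rewrite [LHS](_ : _ = \sum_(p in P) f (deg p.1 + deg p.2)); last first.
  apply: eq_bigr => -[u v]; rewrite !inE /= => /andP[/andP[uA vA] _].
  rewrite /f /h /= big_setU1 ?big_set1 //= inE.
  by apply: contraNneq vA => <-.
rewrite [RHS](_ : _ = \sum_(p in setX A (~: A) | adj p.1 p.2) f (deg p.1 + deg p.2)).
  by apply: eq_bigl => p; rewrite inE.
by rewrite big_mkcondr.
Qed.

Lemma deg_le_part u : u \in A -> (deg u <= #|~: A|)%N.
Proof.
move=> uA; apply/subset_leq_card/subsetP => v; rewrite !inE => /bipA.
by rewrite uA; case: (v \in A).
Qed.

Lemma deg_gt0 (u v : G) : adj u v -> (0 < deg u)%N.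
Proof. by move=> uv; apply/card_gt0P; exists v; rewrite inE. Qed.

Lemma deg_nonadj u v : u \in A -> v \notin A -> ~~ adj u v ->
  (deg u <= #|~: A|.-1)%N.
Proof.
move=> uA vA uv; rewrite (cardsD1 v (~: A)) inE vA /=.
apply/subset_leq_card/subsetP => w; rewrite !inE => uw.
have := bipA uw; rewrite uA; case: (w \in A) => // _; rewrite andbT.
by apply: contraTneq uw => ->.
Qed.

Lemma edge_weight_le p s : (deg p.1 + deg p.2 <= s)%N ->
  edge_weight p <= f s.
Proof.
move=> hs; rewrite /edge_weight; case: ifP => [h|_]; last exact: weight_ge0.
apply: weight_le; rewrite hs andbT -addn1 leq_add ?(deg_gt0 h) //.
by apply: (@deg_gt0 _ p.1); rewrite adj_sym.
Qed.

End Bipartite.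

(** * Upper bounds on ABS from a bipartition *)

Section Bounds.
Variables (R : realType) (G : sgraph) (A : {set G}).
Hypothesis bipA : bipartition A.
Local Notation f := (@weight R).
Local Notation bipAC := (bipartitionC bipA).

Lemma deg_le_partC v : v \notin A -> (deg v <= #|A|)%N.
Proof.
move=> vA; have := @deg_le_part _ _ bipAC v.
by rewrite setCK inE; apply.
Qed.

Lemma deg_nonadjC u v : u \in A -> v \notin A -> ~~ adj u v ->
  (deg v <= #|A|.-1)%N.
Proof.
move=> uA vA uv; have := @deg_nonadj _ _ bipAC v u.
by rewrite setCK !inE negbK adj_sym; apply.
Qed.

Definition cross_pairs := [set p in setX A (~: A) | adj p.1 p.2].

(** Each degree is at most the size of the opposite part, so no edge has degree sum above [#|G|]. *)
Lemma ABS_le_edges : ABS G R <= #|cross_pairs|%:R * f #|G|.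
Proof.
rewrite (ABS_bipartition R bipA) mulr_natl -sumr_const big_mkcond /=.
rewrite [leRHS]big_mkcond; apply: ler_sum => -[u v] _; rewrite !inE /=.
case: ifP => //= /andP[uA vA]; rewrite /edge_weight /=; case: ifP => // uv.
have := @edge_weight_le R G (u, v) #|G|; rewrite /edge_weight /= uv; apply.
by rewrite -(cardsC A) addnC leq_add // (deg_le_partC, deg_le_part bipA).
Qed.

(** A missing pair contributes 0 where the bound has a positive weight, so equality forces all cross
    pairs to be adjacent. *)
Lemma ABS_le_complete : (3 <= #|G|)%N ->
  let bound := (#|A| * #|~: A|)%:R * f #|G| in
  ABS G R <= bound /\
  (ABS G R = bound <-> forall u v, u \in A -> v \notin A -> adj u v).
Proof.
move=> hn /=.
have sumE : (#|A| * #|~: A|)%:R * f #|G| = \sum_(p in setX A (~: A)) f #|G|.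
  by rewrite sumr_const cardsX mulr_natl.
have hle p : p \in setX A (~: A) -> edge_weight R p <= f #|G|.
  move=> hp; apply: edge_weight_le; move: hp; case: p => u v.
  rewrite !inE /= => /andP[uA vA].
  by rewrite -(cardsC A) addnC leq_add // (deg_le_partC, deg_le_part bipA).
rewrite sumE (ABS_bipartition R bipA); split; first exact: ler_sum.
split=> [/(sum_eq_of_le hle) h u v uA vA | h].
  have /h : (u, v) \in setX A (~: A) by rewrite !inE uA vA.
  rewrite /edge_weight /=; case: ifP => // _ /eqP.
  by rewrite lt_eqF // weight_gt0.
apply: eq_bigr => -[u v]; rewrite !inE /= => /andP[uA vA].
rewrite /edge_weight /= h //; congr f.
rewrite -(cardsC A) addnC; congr (_ + _)%N; apply: eq_card => w; rewrite !inE.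
  apply/idP/idP => [/bipA|wA]; last by rewrite adj_sym h.
  by rewrite (negbTE vA); case: (w \in A).
by apply/idP/idP => [/bipA|wA]; [rewrite uA; case: (w \in A)|rewrite h].
Qed.

(** An edge at [u0] has degree sum at most [#|A| + deg u0]; any other has at most [n], and at most
    [n - 1] if its end outside [A] is not adjacent to [u0]. These bounds form [w], whose sum is
    [low_degree_value]. Away from [u0], [w] is positive on every pair, so equality forces those
    pairs to be adjacent. *)
Lemma ABS_le_low_degree u0 : u0 \in A -> (4 <= #|G|)%N ->
  let bound := low_degree_value R #|G| #|A|.-1 (deg u0) in
  ABS G R <= bound /\
  (ABS G R = bound <->
   forall u v, u \in A -> u != u0 -> v \notin A -> adj u v).
Proof.
move=> u0A hn /=; set n := #|G|.
pose w (u v : G) := if u == u0 then if adj u0 v then f (#|A| + deg u0) else 0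
  else if adj u0 v then f n else f n.-1.
have nE : n = (#|A| + #|~: A|)%N by rewrite cardsC.
have A0 : (0 < #|A|)%N by apply/card_gt0P; exists u0.
have sumE : low_degree_value R n #|A|.-1 (deg u0) =
    \sum_(p in setX A (~: A)) w p.1 p.2.
  rewrite (eq_bigl (fun p => (p.1 \in A) && (p.2 \in ~: A))); last first.
    by move=> [u v]; rewrite in_setX.
  rewrite -(pair_big (mem A) (mem (~: A)) w) /= (bigD1 u0) //=.
  have degE : deg u0 = #|[set v in ~: A | adj u0 v]|.
    apply: eq_card => v; rewrite !inE; have [/bipA|] := boolP (adj u0 v).
      by rewrite u0A; case: (v \in A).
    by rewrite andbF.
  (* Each row of [w] takes one value on the neighbours of [u0] and another elsewhere. *)
  have sumB (x y : R) : \sum_(v in ~: A) (if adj u0 v then x else y) =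
      (deg u0)%:R * x + (#|~: A|%:R - (deg u0)%:R) * y.
    rewrite (bigID (fun v => adj u0 v)) /=; congr (_ + _).
      rewrite (eq_bigr (fun=> x)); last by move=> v /andP[_ ->].
      rewrite sumr_const mulr_natl degE; congr (_ *+ _).
      by apply: eq_card => v; rewrite unfold_in !inE.
    rewrite (eq_bigr (fun=> y)); last by move=> v /andP[_ /negbTE ->].
    rewrite sumr_const -natrB ?mulr_natl ?deg_le_part //; congr (_ *+ _).
    rewrite degE -(cardsID [set v | adj u0 v] (~: A)) -setIdE addKn.
    by apply: eq_card => v; rewrite unfold_in !inE andbC.
  have -> : \sum_(v in ~: A) w u0 v = (deg u0)%:R * f (#|A| + deg u0).
    by rewrite /w eqxx sumB mulr0 addr0.
  have -> : \sum_(u in A | u != u0) \sum_(v in ~: A) w u v =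
    \sum_(u in A :\ u0) ((deg u0)%:R * f n + (#|~: A|%:R - (deg u0)%:R) * f n.-1).
    rewrite [RHS](eq_bigl (fun u => (u \in A) && (u != u0))); last first.
      by move=> u; rewrite in_setD1 andbC.
    apply: eq_bigr => u /andP[_ /negbTE uu0].
    by rewrite -sumB; apply: eq_bigr => v _; rewrite /w uu0.
  rewrite sumr_const -[X in _ = _ + X]mulr_natl; have := cardsD1 u0 A; rewrite u0A add1n => cA.
  rewrite /low_degree_value nE cA /= addn1 addSn.
  set c := #|A :\ u0|; set q := #|~: A|.
  have -> : (c + q).+1%:R = c%:R + q%:R + 1 :> R by rewrite -addn1 !natrD.
  by ring.
have hle p : p \in setX A (~: A) -> edge_weight R p <= w p.1 p.2.
  case: p => u v; rewrite !inE /= => /andP[uA vA].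
  have le (s : nat) := @edge_weight_le R G (u, v) s.
  rewrite /w; have [uu0|uu0] := eqVneq u u0.
    case: ifP => h; last by rewrite /edge_weight /= uu0 h.
    by apply: le; rewrite /= addnC uu0 leq_add2r deg_le_partC.
  case: ifP => h; apply: le => /=; rewrite nE.
    by rewrite addnC leq_add // (deg_le_partC, deg_le_part bipA).
  have := deg_nonadjC u0A vA (negbT h); have := deg_le_part bipA uA.
  by clear -A0; lia.
rewrite sumE (ABS_bipartition R bipA); split; first exact: ler_sum.
split=> [/(sum_eq_of_le hle) h u v uA uu0 vA | h].
  have /h : (u, v) \in setX A (~: A) by rewrite !inE uA vA.
  rewrite /edge_weight /w /= (negbTE uu0); case: ifP => // _ /eqP.
  by rewrite lt_eqF //; case: ifP => _; apply: weight_gt0; lia.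
have hu u : u \in A -> u != u0 -> deg u = #|~: A|.
  move=> uA uu0; apply: eq_card => v; rewrite !inE.
  by apply/idP/idP => [/bipA|vA]; [rewrite uA; case: (v \in A)|rewrite h].
have hv v : v \notin A -> deg v = (#|A|.-1 + adj u0 v)%N.
  move=> vA; rewrite /deg (cardsD1 u0) inE adj_sym addnC; congr (_ + _)%N.
  rewrite [in RHS](cardsD1 u0 A) u0A /=.
  apply: eq_card => u; rewrite !inE; case: eqVneq => //= uu0.
  apply/idP/idP => [/bipA|uA]; last by rewrite adj_sym h.
  by rewrite (negbTE vA); case: (u \in A).
apply: eq_bigr => -[u v]; rewrite !inE /= => /andP[uA vA].
rewrite /edge_weight /w /=; have [->|uu0] := eqVneq u u0.
  by case: ifP => // h0; rewrite (hv v vA) h0; congr f; lia.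
rewrite h // (hu u uA uu0) (hv v vA).
by case: ifP => h0; rewrite nE; congr f; lia.
Qed.

End Bounds.

(** * Recognising the extremal graphs up to isomorphism *)

(** An intrinsic form shared by both extremal families: [d = q] gives [Kbip], and [d = k] with parts
    [x + 1] and [y + k] gives [KBar]. *)
Definition almost_complete (p q d : nat) (G : sgraph) : Prop :=
  exists A : {set G}, exists u0 : G,
    [/\ bipartition A, u0 \in A,
        forall u v, u \in A -> u != u0 -> v \notin A -> adj u v &
        [/\ #|A| = p, #|~: A| = q & deg u0 = d]].

Lemma almost_complete_iso p q d (G H : sgraph) :
  almost_complete p q d G -> almost_complete p q d H -> isomorphic G H.
Proof.
(* Adjacency is a function [r] of the classes [cls] of the two endpoints, so a
   class-preserving bijection is an isomorphism. *)
pose cls (G : sgraph) (A : {set G}) u0 (v : G) :=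
  (v \in A, (v == u0) || adj u0 v).
(* In [A] the second flag singles out [u0]; outside [A] it marks the neighbours of [u0]. A cross
   pair is adjacent unless it joins [u0] to an unmarked vertex. *)
pose r (c c' : bool * bool) := (c.1 != c'.1) &&
  (c.2 && c'.2 || c.1 && ~~ c.2 || c'.1 && ~~ c'.2).
have adj_cls (G' : sgraph) (A : {set G'}) u0 : bipartition A -> u0 \in A ->
    (forall u v, u \in A -> u != u0 -> v \notin A -> adj u v) ->
    forall u v, adj u v = r (cls G' A u0 u) (cls G' A u0 v).
  move=> bipA u0A h.
  have hAC u v : u \in A -> v \notin A ->
      adj u v = r (cls G' A u0 u) (cls G' A u0 v).
    move=> uA vA; rewrite /r /cls /= uA (negbTE vA) /= orbF.
    have vu0 : (v == u0) = false by apply: contraNF vA => /eqP ->.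
    have [->|uu0] := eqVneq u u0; first by rewrite vu0 /= orbF.
    rewrite h //= vu0 /=; have := @bipA u0 u; rewrite u0A uA.
    by case: (adj u0 u) => // /(_ isT).
  move=> u v; case uA: (u \in A); case vA: (v \in A).
  - by rewrite /r /cls /= uA vA /=; apply/negP => /bipA; rewrite uA vA.
  - by apply: hAC; rewrite ?uA ?vA.
  - rewrite adj_sym hAC ?uA ?vA // /r [in RHS]eq_sym; congr (_ && _).
    by rewrite [in RHS](andbC (cls _ _ _ _).2) -!orbA; congr (_ || _); rewrite orbC.
  - by rewrite /r /cls /= uA vA /=; apply/negP => /bipA; rewrite uA vA.
have card_cls (G' : sgraph) (A : {set G'}) u0 : bipartition A -> u0 \in A ->
    forall c, #|[set v | cls G' A u0 v == c]| =
     if c.1 then (if c.2 then 1 else #|A|.-1)%N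
     else (if c.2 then deg u0 else #|~: A| - deg u0)%N.
  move=> bipA u0A.
  have nA v : adj u0 v -> v \in A = false.
    by move/bipA; rewrite u0A; case: (v \in A).
  have nu v : v \notin A -> (v == u0) = false.
    by move=> vA; apply: contraNF vA => /eqP ->.
  case=> -[] [] /=; rewrite /cls.
  - rewrite -(cards1 u0); apply: eq_card => v; rewrite !inE xpair_eqE.
    have [->|vu0] := eqVneq v u0; first by rewrite u0A.
    by case: (boolP (adj u0 v)) => [/nA ->//|_]; rewrite andbF.
  - rewrite [in RHS](cardsD1 u0 A) u0A /=; apply: eq_card => v.
    rewrite !inE xpair_eqE; have [->|vu0] := eqVneq v u0; first by rewrite andbF.
    by case: (boolP (adj u0 v)) => [/nA ->//|_]; rewrite eqbF_neg andbT eqb_id.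
  - apply: eq_card => v; rewrite !inE xpair_eqE.
    case: (boolP (adj u0 v)) => [/nA ->//|_]; first by rewrite orbT.
    by case: (boolP (v \in A)) => //= vA; rewrite nu.
  - rewrite -(cardsID [set v | adj u0 v] (~: A)).
    have -> : ~: A :&: [set v | adj u0 v] = [set v | adj u0 v].
      by apply/setP => v; rewrite !inE; case: (boolP (adj u0 v)) => [/nA ->//|]; rewrite andbF.
    rewrite addKn; apply: eq_card => v; rewrite !inE xpair_eqE.
    by case: (boolP (v \in A)) => //= vA; rewrite ?andbF // nu //= andbT eqbF_neg.
case=> A [u0 [bA u0A hA [cA cB du]]] [A' [u0' [bA' u0A' hA' [cA' cB' du']]]].
have [c|f [fbij fc]] := @class_preserving_bij G H _ (cls G A u0) (cls H A' u0').
  by rewrite !card_cls // cA cA' cB cB' du du'.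
exists f; split=> // u v.
by rewrite (adj_cls _ _ _ bA' u0A' hA') !fc -(adj_cls _ _ _ bA u0A hA).
Qed.

Lemma almost_complete_transfer p q d (G H : sgraph) :
  isomorphic G H -> almost_complete p q d H -> almost_complete p q d G.
Proof.
case=> f [fbij fadj] [A [u0 [bA u0A hA [cA cB du]]]].
have [g gK fK] := fbij.
have cardf (B : {set H}) : #|f @^-1: B| = #|B|.
  by rewrite on_card_preimset //; exact: onW_bij.
exists (f @^-1: A), (g u0); split.
- by move=> u v uv; rewrite !inE bA ?fadj.
- by rewrite inE fK.
- move=> u v; rewrite !inE -fadj => uA uu0 vA; apply: hA => //.
  by apply: contraNneq uu0 => <-; rewrite gK.
- split; first by rewrite cardf.
    by rewrite -preimsetC cardf.
  rewrite -du /deg -cardf; apply: eq_card => v.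
  by rewrite !inE -fadj fK.
Qed.

Lemma sum1T (T : finType) : (\sum_(i : T) 1)%N = #|T|.
Proof. exact: sum1_card. Qed.

Lemma almost_complete_KBar k x y :
  almost_complete x.+1 (y + k) k (KBar k x y).
Proof.
pose isA (v : KBar k x y) := if v is inl (inl _) then true else false.
(* The parts are [H1] with [H3] and [H4] with [H5]; the vertex of [H3] is the exceptional one. *)
exists [set v | isA v], (inl (inl (inr tt))); split.
- by move=> [[[u|u]|u]|u] [[[v|v]|v]|v]; rewrite !inE.
- by rewrite inE.
- by move=> [[[u|[]]|u]|u] [[[v|v]|v]|v]; rewrite !inE.
- split.
by rewrite -sum1dep_card !big_sumType /= !big_pred0_eq !sum1T card_ord card_unit !addn0 addn1.
  + rewrite -sum1_card; under eq_bigl do rewrite !inE.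
    by rewrite !big_sumType /= ?big_pred0_eq !sum1T !card_ord.
  + by rewrite /deg -sum1dep_card !big_sumType /= ?big_pred0_eq !sum1T ?card_ord ?addn0.
Qed.

(** Any vertex of the first part can serve as [u0]; [0 < a] supplies one. *)
Lemma almost_complete_Kbip a b : (0 < a)%N -> almost_complete a b b (Kbip a b).
Proof.
case: a => // a _.
exists [set v | if v is inl _ then true else false], (inl ord0); split.
- by move=> [u|u] [v|v]; rewrite !inE.
- by rewrite inE.
- by move=> [u|u] [v|v]; rewrite !inE.
- split.
  + by rewrite -sum1dep_card !big_sumType /= ?big_pred0_eq !sum1T ?card_ord ?addn0.
  + rewrite -sum1_card; under eq_bigl do rewrite !inE.
    by rewrite !big_sumType /= ?big_pred0_eq !sum1T !card_ord.
  + by rewrite /deg -sum1dep_card !big_sumType /= ?big_pred0_eq !sum1T ?card_ord ?addn0.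
Qed.

Lemma isomorphic_KBarP k x y (G : sgraph) :
  isomorphic G (KBar k x y) <-> almost_complete x.+1 (y + k) k G.
Proof.
split=> [h|h]; first exact: almost_complete_transfer h (almost_complete_KBar _ _ _).
exact: almost_complete_iso h (almost_complete_KBar _ _ _).
Qed.

Lemma isomorphic_KbipP a b (G : sgraph) : (0 < a)%N ->
  isomorphic G (Kbip a b) <->
  exists A : {set G}, [/\ bipartition A, #|A| = a, #|~: A| = b &
    forall u v, u \in A -> v \notin A -> adj u v].
Proof.
move=> a0; split=> [h|[A [bA cA cB hA]]].
  have [A [u0 [bA u0A hA [cA cB du]]]] :=
    almost_complete_transfer h (almost_complete_Kbip b a0).
  exists A; split=> // u v uA vA; have [->|uu0] := eqVneq u u0; last exact: hA.
  (* The neighbourhood of [u0] lies in [~: A] and has the same size, so it is all of it. *)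
  have sub : [set w | adj u0 w] \subset ~: A.
    by apply/subsetP => w; rewrite !inE => /bA; rewrite u0A; case: (w \in A).
  have /eqP e : [set w | adj u0 w] == ~: A.
    by rewrite eqEcard sub cB -du leqnn.
  have : v \in ~: A by rewrite inE.
  by rewrite -e inE.
apply: almost_complete_iso (almost_complete_Kbip b a0).
have /card_gt0P[u0 u0A] : (0 < #|A|)%N by rewrite cA.
exists A, u0; split=> // [u v uA _ vA|]; first exact: hA.
split=> //; rewrite -cB; apply: eq_card => v; rewrite !inE.
by apply/idP/idP => [/bA|/hA]; [rewrite u0A; case: (v \in A)|apply].
Qed.

(** * Vertex cuts and the missing pairs they force *)

Section Cuts.
Variable G : sgraph.

Lemma connected_deg_gt0 (u : G) : connected G -> (1 < #|G|)%N -> (0 < deg u)%N.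
Proof.
move=> conn c1; have : (0 < #|[set: G] :\ u|)%N.
  by have := cardsD1 u [set: G]; rewrite cardsT inE; lia.
case/card_gt0P=> v; rewrite !inE andbT => vu.
have /connectP[[|w s] /= ] := conn u v.
  by move=> _ e; rewrite e eqxx in vu.
by case/andP=> uw _ _; apply: deg_gt0 uw.
Qed.

(** [C] is the component of a vertex [x] after deleting [S]; [D] is the rest, nonempty because some
    [y] is not reached from [x]. *)
Lemma vertex_cut_split (S : {set G}) : vertex_cut S ->
  exists C D : {set G}, [/\ C != set0, D != set0, C :|: D = ~: S,
    [disjoint C & D] & forall x y, x \in C -> y \in D -> ~~ adj x y].
Proof.
move=> cut.
have [x [y nxy]] : exists x y : del_vertices S, ~~ connect adj x y.
  have [|/existsPn h] := boolP [exists x, exists y, ~~ connect (@adj (del_vertices S)) x y].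
    by case/existsP=> x /existsP[y h]; exists x, y.
  by case: cut => x y; have /existsPn/(_ y) := h x; rewrite negbK.
pose C := [set val z | z : del_vertices S & connect adj x z].
have SC z : z \in C -> z \notin S by case/imsetP => w _ ->; exact: (valP w).
exists C, (~: (S :|: C)); split.
- by apply/set0Pn; exists (val x); apply: imset_f; rewrite inE connect0.
- apply/set0Pn; exists (val y); rewrite !inE negb_or (valP y) /=.
  apply/negP => /imsetP[z]; rewrite inE => xz /val_inj e.
  by rewrite e xz in nxy.
- apply/setP => z; rewrite !inE; have := SC z.
  by case: (z \in C) => [/(_ isT) ->//|_]; rewrite orbF.
- by rewrite disjoint_sym disjoints_subset setCS subsetUr.
- move=> z w; case/imsetP => z' xz' ->; rewrite !inE in xz' *.
  rewrite negb_or => /andP[wS wC].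
  apply: contra wC => zw; apply/imsetP; exists (exist _ w wS) => //.
  by rewrite inE; apply: connect_trans xz' (connect1 _).
Qed.

(** What remains is an independent set with at least two vertices. *)
Lemma vertex_cut_part (A : {set G}) : bipartition A -> (2 <= #|A|)%N ->
  vertex_cut (~: A).
Proof.
move=> bA /card_gt1P[x [y [xA yA xy]]] conn.
have xS : x \notin ~: A by rewrite inE xA.
have yS : y \notin ~: A by rewrite inE yA.
have /connectP[[|[w wS] s] /=] := conn (exist _ x xS) (exist _ y yS).
  by move=> _ /(congr1 val) /= e; rewrite e eqxx in xy.
have wA : w \in A by rewrite inE negbK in wS.
by case/andP=> /bA /=; rewrite xA wA.
Qed.

(** [C] lies in one part, so a vertex of [C] has no neighbour in [C], and none in [D]: all its
    neighbours are in [S]. *)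
Lemma low_degree_of_cut (A S C D : {set G}) :
  bipartition A -> C != set0 -> C :|: D = ~: S ->
  (forall x y, x \in C -> y \in D -> ~~ adj x y) -> C :&: A = set0 ->
  exists u : G, (deg u <= #|S|)%N.
Proof.
move=> bA /set0Pn[u uC] CD nadj CA; exists u.
have nA v : v \in C -> v \notin A.
  by move=> vC; apply/negP => vA; have := in_set0 v; rewrite -CA inE vC vA.
apply/subset_leq_card/subsetP => v; rewrite inE => uv.
have vA : v \in A by have := bA _ _ uv; rewrite (negbTE (nA _ uC)); case: (v \in A).
apply/negPn/negP => vS; have : v \in C :|: D by rewrite CD inE.
by rewrite inE => /orP[/nA|/(nadj _ _ uC)]; rewrite ?vA ?uv.
Qed.

(** The pairs between [C] and [D] across the bipartition fill two disjoint rectangles with nonzero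
    sides. By [a * b >= a + b - 1] for each, at least [#|C| + #|D| - 2] pairs are missing. *)
Lemma cross_pairs_cut (A S C D : {set G}) :
  C :|: D = ~: S -> [disjoint C & D] ->
  (forall x y, x \in C -> y \in D -> ~~ adj x y) ->
  C :&: A != set0 -> D :&: A != set0 ->
  C :&: ~: A != set0 -> D :&: ~: A != set0 ->
  (#|cross_pairs A| + (#|G| - #|S| - 2) <= #|A| * #|~: A|)%N.
Proof.
move=> CD dCD nadj; rewrite -!card_gt0 => ca da cb db.
have cCD : (#|C| + #|D| = #|G| - #|S|)%N.
  by rewrite -cardsUI CD (disjoint_setI0 dCD) cards0 addn0 -(cardsC S) addKn.
rewrite -(cardsID A C) -(cardsID A D) !setDE in cCD.
have nCD z : z \in C -> z \in D -> False.
  by move=> zC zD; have := disjointFr dCD zC; rewrite zD.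
pose X := setX (C :&: A) (D :&: ~: A); pose Y := setX (D :&: A) (C :&: ~: A).
have cXY : (#|X :|: Y| = #|X| + #|Y|)%N.
  rewrite -cardsUI; have -> : X :&: Y = set0; last by rewrite cards0 addn0.
  apply/setP => -[u v]; rewrite !inE /=; apply/negP.
  by case/and3P=> /andP[/andP[uC _] _] /andP[uD _] _; exact: nCD uC uD.
have : (#|cross_pairs A :|: (X :|: Y)| <= #|setX A (~: A)|)%N.
  apply/subset_leq_card/subsetP => -[u v]; rewrite !inE /=.
  by case: (u \in A); case: (v \in A); rewrite ?andbF.
have -> : (#|cross_pairs A :|: (X :|: Y)| = #|cross_pairs A| + (#|X| + #|Y|))%N.
  rewrite -cXY -[RHS]cardsUI.
  have -> : cross_pairs A :&: (X :|: Y) = set0; last by rewrite cards0 addn0.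
  apply/setP => -[u v]; rewrite !inE /=; apply/negP => /andP[/andP[_ uv]].
  case/orP=> /andP[/andP[h _] /andP[h' _]].
    by have := nadj _ _ h h'; rewrite uv.
  by have := nadj _ _ h' h; rewrite adj_sym uv.
rewrite !cardsX.
move: ca da cb db cCD; set a1 := #|_|; set a2 := #|_|; set b1 := #|_|; set b2 := #|_|.
clear; move=> *; nia.
Qed.

End Cuts.

(** * Combining the cuts with the bounds *)

Lemma bipartition_of_vertex (G : sgraph) (u : G) :
  bipartite G -> exists A : {set G}, bipartition A /\ u \in A.
Proof.
case=> A bA; have [uA|uA] := boolP (u \in A); first by exists A.
by exists (~: A); rewrite inE; split=> //; exact: bipartitionC.
Qed.

Lemma ABS_le_KBar (R : realType) (n k m : nat) (G : sgraph) :
  (7 <= n)%N -> BG n k G -> (0 < k < m)%N -> (n <= 2 * m + 1)%N ->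
  (2 * m <= n)%N ->
  ABS G R <= low_degree_value R n m k /\
  (ABS G R = low_degree_value R n m k <->
   isomorphic G (KBar k m (n - 1 - m - k))).
Proof.
move=> hn [cG conn bip [[S [cutS cS]] _]] /andP[k0 km] mn1 mn2.
have isoE : isomorphic G (KBar k m (n - 1 - m - k)) <->
    almost_complete m.+1 (n - m.+1) k G.
  by rewrite isomorphic_KBarP; have -> : (n - 1 - m - k + k = n - m.+1)%N by lia.
rewrite isoE.
have eq_of_iso : almost_complete m.+1 (n - m.+1) k G ->
    ABS G R = low_degree_value R n m k.
  case=> A [u0 [bA u0A hA [cA _ du]]].
  have [|_ h] := ABS_le_low_degree R bA u0A; first lia.
  by move: h; rewrite cG cA du => /= ->.
have [/existsP[u du]|low] := boolP [exists u : G, (deg u <= k)%N].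
  have [A [bA uA]] := bipartition_of_vertex u bip.
  have d0 : (0 < deg u)%N by apply: (connected_deg_gt0 u conn); lia.
  have [|le_u eq_u] := ABS_le_low_degree R bA uA; first lia.
  rewrite cG in le_u eq_u.
  have [] := @low_degree_value_le_max R n hn k m k0 km mn1 mn2 #|A|.-1 (deg u).
    by rewrite d0.
  move=> le_max eq_max; split; first exact: le_trans le_u le_max.
  split=> // e.
  (* Equality squeezes the intermediate value, and [eq_max] then fixes [#|A|] and [deg u]. *)
  have e' : low_degree_value R n #|A|.-1 (deg u) = low_degree_value R n m k.
    by apply/le_anti; rewrite le_max -e.
  move: eq_max; rewrite e' eqxx => /esym /andP[/eqP cA /eqP edu].
  have A0 : (0 < #|A|)%N by apply/card_gt0P; exists u.
  exists A, u; split=> //; first by apply/eq_u; rewrite e'.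
  by have := cardsC A; rewrite cG => hc; split=> //; lia.
have [A bA] := bip.
have [C [D [C0 D0 CD dCD nadj]]] := vertex_cut_split cutS.
have dgt (u : G) : (#|S| < deg u)%N.
  by rewrite cS ltnNge; apply: contra low => du; apply/existsP; exists u.
(* With all degrees above [k], neither side of the cut lies within one part, so all four
   intersections are nonempty. *)
have meets (X Y : {set G}) : X != set0 -> X :|: Y = ~: S ->
    (forall x y, x \in X -> y \in Y -> ~~ adj x y) ->
    forall B : {set G}, bipartition B -> X :&: B != set0.
  move=> X0 XY hXY B bB; apply/eqP => XB.
  have [u] := low_degree_of_cut bB X0 XY hXY XB.
  by rewrite leqNgt dgt.
have DC : D :|: C = ~: S by rewrite setUC.
have nadj' x y : x \in D -> y \in C -> ~~ adj x y.
  by move=> xD yC; rewrite adj_sym nadj.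
have bA' := bipartitionC bA.
have := cross_pairs_cut CD dCD nadj (meets _ _ C0 CD nadj A bA)
  (meets _ _ D0 DC nadj' A bA) (meets _ _ C0 CD nadj _ bA')
  (meets _ _ D0 DC nadj' _ bA').
rewrite cG cS => few.
have pq : (#|A| + #|~: A| = n)%N by rewrite cardsC.
have lt : ABS G R < low_degree_value R n m k.
  apply: le_lt_trans (ABS_le_edges R bA) _; rewrite cG.
  exact: (few_edges_lt_max R hn k0 km mn1 mn2 pq few).
split; first exact: ltW.
by split=> // e; rewrite e ltxx in lt.
Qed.

(** If the other part has two vertices, [A] is a cut; otherwise [A] misses at most one vertex. *)
Lemma card_part_ge (n k : nat) (G : sgraph) (A : {set G}) :
  BG n k G -> bipartition A -> (0 < n)%N -> (2 * k <= n)%N -> (k <= #|A|)%N.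
Proof.
move=> [cG conn _ [_ minS]] bA n0 kn.
have cA := cardsC A; rewrite cG in cA.
have [h|h] := leqP 2 #|~: A|; last by lia.
by have /minS := vertex_cut_part (bipartitionC bA) h; rewrite setCK.
Qed.

(** Both parts have at least [k] vertices and [n <= 2k + 2], so either one part has exactly [k],
    where [ABS_le_complete] applies, or both have [k + 1]. In the latter case a cut of size [k]
    excludes completeness and the bound is strict. *)
Lemma ABS_le_Kbip (R : realType) (n k : nat) (G : sgraph) :
  (7 <= n)%N -> BG n k G -> (n <= 2 * k + 2)%N -> (2 * k <= n)%N ->
  let bound : R := k%:R * (n%:R - k%:R) * weight R n in
  ABS G R <= bound /\ (ABS G R = bound <-> isomorphic G (Kbip k (n - k))).
Proof.
move=> hn hG nk kn bound; rewrite isomorphic_KbipP; last lia.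
have [cG conn [A bA] [[S [cutS cS]] _]] := hG.
have boundE (B : {set G}) : #|B| = k ->
    (#|B| * #|~: B|)%:R * weight R #|G| = bound.
  move=> cB; have cC := cardsC B; rewrite cG cB in cC.
  have -> : #|~: B| = (n - k)%N by lia.
  by rewrite cB cG natrM natrB //; lia.
have eq_of_iso : (exists B : {set G}, [/\ bipartition B, #|B| = k, #|~: B| = (n - k)%N &
    forall u v, u \in B -> v \notin B -> adj u v]) -> ABS G R = bound.
  case=> B [bB cB _ hB].
  have [|_ /= h] := ABS_le_complete R bB; first lia.
  by rewrite -(boundE _ cB); apply/h.
have balanced (B : {set G}) : bipartition B -> #|B| = k -> ABS G R <= bound /\
    (ABS G R = bound <->
     exists B : {set G}, [/\ bipartition B, #|B| = k, #|~: B| = (n - k)%N &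
       forall u v, u \in B -> v \notin B -> adj u v]).
  move=> bB cB; have [|/= le h] := ABS_le_complete R bB; first lia.
  rewrite boundE // in le h; split=> //; split=> // /h hB.
  by exists B; split=> //; have := cardsC B; lia.
have kA : (k <= #|A|)%N by apply: (card_part_ge hG bA); lia.
have kA' : (k <= #|~: A|)%N by apply: (card_part_ge hG (bipartitionC bA)); lia.
have cA := cardsC A; rewrite cG in cA.
have [e|neA] := eqVneq #|A| k; first exact: (balanced A).
have [e|neA'] := eqVneq #|~: A| k.
  by apply: (balanced (~: A)) => //; exact: bipartitionC.
have eA : #|A| = k.+1 by lia.
have eA' : #|~: A| = k.+1 by lia.
have en : n = (2 * k + 2)%N by lia.
have [u [v [uA vA uv]]] : exists u v : G, [/\ u \in A, v \notin A & ~~ adj u v].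
  have [C [D [/set0Pn[x xC] /set0Pn[y yD] CD _ nadj]]] := vertex_cut_split cutS.
  have outS z : (z \in C) || (z \in D) -> z \notin S.
    by move=> h; have : z \in C :|: D by [rewrite inE]; rewrite CD inE.
  (* If [x] and [y] lie in the same part, the opposite part has [k + 1] vertices, more than [S]; one
     outside [S] lies in [C] or [D] and is non-adjacent to [y] or [x] respectively. *)
  have part (B : {set G}) : bipartition B -> #|~: B| = k.+1 ->
      x \in B -> y \in B -> exists u v : G, [/\ u \in B, v \notin B & ~~ adj u v].
    move=> bB cB xB yB.
    have /subsetPn[z] : ~~ (~: B \subset S).
      by apply/negP => /subset_leq_card; rewrite cB cS ltnn.
    rewrite inE => zB zS; have : z \in C :|: D by rewrite CD inE.
    rewrite inE => /orP[zC|zD].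
      by exists y, z; split=> //; rewrite adj_sym nadj.
    by exists x, z; split=> //; rewrite nadj.
  have [xA|xA] := boolP (x \in A); have [yA|yA] := boolP (y \in A).
  - exact: part.
  - by exists x, y; split=> //; exact: nadj.
  - by exists y, x; split=> //; rewrite adj_sym nadj.
  - have [|||u [v []]] := part _ (bipartitionC bA); rewrite ?setCK ?inE //.
    by rewrite negbK => uA vA uv; exists v, u; rewrite adj_sym.
have du : (deg u <= k)%N by have := deg_nonadj bA uA vA uv; rewrite eA'.
have d0 : (0 < deg u)%N by apply: (connected_deg_gt0 u conn); lia.
have [|/= le_u _] := ABS_le_low_degree R bA uA; first lia.
have lt : ABS G R < bound.
  apply: (le_lt_trans le_u); rewrite cG eA /=.
  (* For [n = 2k + 2] this value is [k^2 * weight n + 2k * weight n.-1], against the bound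
     [k * (k + 2) * weight n]. *)
  apply: (@le_lt_trans _ _ (low_degree_value R n k k)).
    have [->//|nd] := eqVneq (deg u) k.
    by apply/ltW/low_degree_value_lt; lia.
  have hlt := weight_pred_lt R hn.
  rewrite /low_degree_value /bound.
  have -> : (k + 1 + k)%N = n.-1 by lia.
  have enR : n%:R = 2 * k%:R + 2 :> R by rewrite en natrD natrM.
  have k0 : 0 < k%:R :> R by rewrite ltr0n; lia.
  have h : k%:R * weight R n.-1 < k%:R * weight R n by rewrite ltr_pM2l.
  by rewrite enR; lra.
split; first exact: ltW.
by split=> [e|/eq_of_iso e]; rewrite e ltxx in lt.
Qed.

Theorem theorem4p12 (R : realType) (n k : nat) (G : sgraph)
    (hn : (7 <= n)%N) (hG : BG n k G) :
  (* (i) *)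
  ((2 * k = n - 2 \/ 2 * k = n - 1 \/ 2 * k = n)%N ->
    let bound : R := k%:R * (n%:R - k%:R) * Num.sqrt (1 - 2 / n%:R) in
    ABS G R <= bound /\
    (ABS G R = bound <-> isomorphic G (Kbip k (n - k)))) /\
  (* (ii) *)
  (~~ odd n -> (1 <= k)%N -> (2 * k <= n - 4)%N ->
    let bound : R :=
      n%:R * (n%:R - 2 * k%:R - 2) / 4 * Num.sqrt (1 - 2 / (n%:R - 1))
      + n%:R * k%:R / 2 * Num.sqrt (1 - 2 / n%:R)
      + k%:R * Num.sqrt (1 - 4 / (2 * k%:R + n%:R + 2)) in
    ABS G R <= bound /\
    (ABS G R = bound <->
      isomorphic G (KBar k (n %/ 2) ((n - 2 * k - 2) %/ 2)))) /\
  (* (iii) *)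
  (odd n -> (1 <= k)%N -> (2 * k <= n - 3)%N ->
    let bound : R :=
      (n%:R - 1) * (n%:R - 2 * k%:R - 1) / 4 * Num.sqrt (1 - 2 / (n%:R - 1))
      + (n%:R - 1) * k%:R / 2 * Num.sqrt (1 - 2 / n%:R)
      + k%:R * Num.sqrt (1 - 4 / (2 * k%:R + n%:R + 1)) in
    ABS G R <= bound /\
    (ABS G R = bound <->
      isomorphic G (KBar k ((n - 1) %/ 2) ((n - 2 * k - 1) %/ 2)))).
Proof.
have predE : n.-1%:R = n%:R - 1 :> R by rewrite -subn1 natrB //; lia.
(* Used with [s = m + 1 + k], the degree sum along an edge at the low-degree vertex. *)
have weight4 (s : nat) (t : R) : 2 * s%:R = t -> (0 < s)%N ->
    Num.sqrt (1 - 4 / t) = weight R s.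
  move=> <- s0; congr (Num.sqrt (1 - _)); field.
  by rewrite pnatr_eq0; lia.
have weightE (s : nat) : Num.sqrt (1 - 2 / s%:R) = weight R s by [].
split; first by move=> hk; apply: ABS_le_Kbip => //; lia.
(* With [m] the floor of [n / 2], both parities reduce to [ABS_le_KBar]; only the closed form of the
   bound differs. *)
split=> no k1 hk bound.
  have [m nm] : exists m, n = (2 * m)%N by exists n./2; lia.
  have nR : n%:R = 2 * m%:R :> R by rewrite nm natrM.
  have -> : (n %/ 2 = m)%N by lia.
  have -> : ((n - 2 * k - 2) %/ 2 = n - 1 - m - k)%N by lia.
  have -> : bound = low_degree_value R n m k; last by apply: ABS_le_KBar => //; lia.
  rewrite /bound -predE !weightE (weight4 (m + 1 + k)%N); last by lia.
    by rewrite /low_degree_value ?predE nR; field.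
  by rewrite !natrD nR; ring.
have [m nm] : exists m, n = (2 * m + 1)%N by exists n./2; lia.
have nR : n%:R = 2 * m%:R + 1 :> R by rewrite nm natrD natrM.
have -> : ((n - 1) %/ 2 = m)%N by lia.
have -> : ((n - 2 * k - 1) %/ 2 = n - 1 - m - k)%N by lia.
have -> : bound = low_degree_value R n m k; last by apply: ABS_le_KBar => //; lia.
rewrite /bound -predE !weightE (weight4 (m + 1 + k)%N); last by lia.
  by rewrite /low_degree_value ?predE nR; field.
by rewrite !natrD nR; ring.
Qed.
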